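(* Let $A\in\mathbb{C}^{p\times q}$, $B\in\mathbb{C}^{p\times m}$, $C\in\mathbb{C}^{n\times q}$, and let their restricted singular value decomposition (RSVD) be given, with block sizes $p_1,\dots,p_6$, $q_1,\dots,q_6$, $m_1,\dots,m_4$, $n_1,\dots,n_4$ and restricted singular values as described in the context. Then the Kronecker canonical form (KCF) of the $(p+q+m+n)\times(p+q+m+n)$ pencil $$\mathcal A-\lambda\mathcal B=\begin{bmatrix} 0 & A & 0 & 0 \\ A^* & 0 & 0 & 0 \\ 0 & 0 & I & 0 \\ 0 & 0 & 0 & I \end{bmatrix}-\lambda\begin{bmatrix} 0 & 0 & B & 0 \\ 0 & 0 & 0 & C^* \\ B^* & 0 & 0 & 0 \\ 0 & C & 0 & 0 \end{bmatrix}$$ (block rows and block columns of sizes $p,q,m,n$) consists of the following blocks: 1. a $(p_6+q_1)\times(p_6+q_1)$ zero block (corresponding to restricted singular triplets of the form $(0,0,0)$); 2. a series of $p_4+q_6+m_3+n_4$ blocks $N_1$ (corresponding to $(1,0,0)$ triplets); 3. a series of $p_2$ blocks $N_3$ (corresponding to $(1,1,0)$ triplets); 4. a series of $p_3$ blocks $N_3$ (corresponding to $(1,0,1)$ triplets); 5. a series of $p_5+q_2=m_4+n_1$ blocks $J_2(0)$ (corresponding to $(0,1,1)$ triplets); 6. the blocks $J_1(\sqrt{\sigma_j})$, $J_1(-\sqrt{\sigma_j})$, $J_1(i\sqrt{\sigma_j})$, $J_1(-i\sqrt{\sigma_j})$ for $j=1,\dots,p_1$, where $\sigma_1,\dots,\sigma_{p_1}$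 are the finite and nonzero restricted singular values of the matrix triplet $(A,B,C)$.
   Context: $I$ denotes an identity matrix of appropriate size, and $M^*$ is the Hermitian transpose of $M$; $M^{-*}=(M^{-1})^*$. RSVD: let $r_A,r_B,r_C$ be the ranks of $A,B,C$, let $r_{AB}=\operatorname{rank}[A\ B]$, $r_{AC}=\operatorname{rank}\begin{bmatrix} A \\ C \end{bmatrix}$, $r_{ABC}=\operatorname{rank}\begin{bmatrix} A & B \\ C & 0 \end{bmatrix}$. Then one can factorize $A=X^{-*}\Sigma_\alpha Y^{-1}$, $B=X^{-*}\Sigma_\beta U^*$, $C=V\Sigma_\gamma Y^{-1}$ with $X\in\mathbb{C}^{p\times p}$, $Y\in\mathbb{C}^{q\times q}$ nonsingular and $U\in\mathbb{C}^{m\times m}$, $V\in\mathbb{C}^{n\times n}$ unitary, where $$\Sigma_\alpha=\begin{bmatrix} 0 & 0 & D_\alpha & 0 & 0 & 0 \\ 0 & 0 & 0 & I & 0 & 0 \\ 0 & 0 & 0 & 0 & I & 0 \\ 0 & 0 & 0 & 0 & 0 & I \\ 0 & 0 & 0 & 0 & 0 & 0 \\ 0 & 0 & 0 & 0 & 0 & 0 \end{bmatrix},\quad \Sigma_\beta=\begin{bmatrix} D_\beta & 0 & 0 & 0 \\ 0 & I & 0 & 0 \\ 0 & 0 & 0 & 0 \\ 0 & 0 & 0 & 0 \\ 0 & 0 & 0 & I \\ 0 & 0 & 0 & 0 \end{bmatrix},\quad \Sigma_\gamma=\begin{bmatrix} 0 & I & 0 & 0 & 0 & 0 \\ 0 &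 0 & D_\gamma & 0 & 0 & 0 \\ 0 & 0 & 0 & 0 & I & 0 \\ 0 & 0 & 0 & 0 & 0 & 0 \end{bmatrix}.$$ The row blocks of $\Sigma_\alpha,\Sigma_\beta$ have sizes $p_1,\dots,p_6$; the column blocks of $\Sigma_\alpha,\Sigma_\gamma$ have sizes $q_1,\dots,q_6$; the column blocks of $\Sigma_\beta$ have sizes $m_1,\dots,m_4$; the row blocks of $\Sigma_\gamma$ have sizes $n_1,\dots,n_4$. These sizes are $p_1=q_3=r_{ABC}+r_A-r_{AB}-r_{AC}$, $p_2=q_4=r_{AC}+r_B-r_{ABC}$, $p_3=q_5=r_{AB}+r_C-r_{ABC}$, $p_4=q_6=r_{ABC}-r_B-r_C$, $p_5=r_{AB}-r_A$, $q_2=r_{AC}-r_A$, $p_6=p-r_{AB}$, $q_1=q-r_{AC}$, $n_1=q_2$, $m_4=p_5$, $n_2=m_1=p_1=q_3$, $n_3=p_3=q_5$, $m_2=p_2=q_4$, $n_4=n-r_C$, $m_3=m-r_B$. Here $D_\alpha=\operatorname{diag}(\alpha_1,\dots,\alpha_{p_1})$, $D_\beta=\operatorname{diag}(\beta_1,\dots,\beta_{p_1})$, $D_\gamma=\operatorname{diag}(\gamma_1,\dots,\gamma_{p_1})$ with $\alpha_j,\beta_j,\gamma_j>0$ and $\alpha_j^2+\beta_j^2\gamma_j^2=1$. Besides the $p_1$ triplets $(\alpha_j,\beta_j,\gamma_j)$ there are $p_2$ triplets $(1,1,0)$, $p_3$ triplets $(1,0,1)$, $p_4$ triplets $(1,0,0)$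 and $\min\{p_5,q_2\}$ triplets $(0,1,1)$. Each such triplet $(\alpha,\beta,\gamma)$ corresponds to a restricted singular value $\sigma=\alpha/(\beta\gamma)$ ($\infty$ if $\alpha\neq0$ and $\beta\gamma=0$); so the finite nonzero restricted singular values are $\sigma_j=\alpha_j/(\beta_j\gamma_j)$, $j=1,\dots,p_1$. Blocks: $J_\delta(\zeta)$ denotes the $\delta\times\delta$ pencil $K-\lambda I$, where $K$ is the Jordan block with $\zeta$ on the diagonal and $1$ on the first superdiagonal; $N_\gamma$ denotes the $\gamma\times\gamma$ pencil $I-\lambda Z$, where $Z$ has ones on the first superdiagonal and zeros elsewhere. The Kronecker canonical form of a pencil $\mathcal A-\lambda\mathcal B$ with $\mathcal A,\mathcal B\in\mathbb{C}^{k\times\ell}$ is the block diagonal pencil (unique up to the order of its diagonal blocks) of the standard Kronecker form (zero block, singular blocks $L_\alpha$, $L_\beta^T$, blocks $N_\gamma$ for infinite eigenvalues, blocks $J_\delta(\zeta)$ for finite eigenvalues) that equals $\mathcal Y^*(\mathcal A-\lambda\mathcal B)\mathcal X$ for some nonsingular $\mathcal X,\mathcal Y$ independent of $\lambda$. ''The KCF consists of the following blocks'' means that there exist such nonsingular $\mathcal X,\mathcal Y$ for which $\mathcal Y^*(\mathcal A-\lambda\mathcal B)\mathcal X$ is block diagonal with exactly the listed blocks (counted with multiplicity) on its diagonal. The parenthetical ''corresponding to'' remarks are only interpretive. *)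

(* Defs.v *)
From HB Require Import structures.
From mathcomp Require Import all_boot all_order all_algebra.
From mathcomp Require Export spectral complex reals.

Set Implicit Arguments.
Unset Strict Implicit.
Unset Printing Implicit Defensive.

Import Order.TTheory GRing.Theory Num.Theory.
Local Open Scope ring_scope.
Local Open Scope sesquilinear_scope.

(* A pencil A - lambda B is given by its coefficient matrices A ([.._lead])
   and B ([.._trail]). *)
Inductive kblock (K : Type) : Type :=
| KZero of nat & nat  (* zero block of the given size; a dimension may be 0 *)
| KL of nat           (* L_a   : a x a.+1,  [0 I] - lambda [I 0]            *)
| KLT of nat          (* L_a^T : a.+1 x a                                   *)
| KN of nat           (* N_g   : I - lambda Z, Z the nilpotent shift        *)
| KJ of nat & K.      (* J_d(z) : (z I + Z) - lambda I                      *)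

Arguments KZero {K}.
Arguments KL {K}.
Arguments KLT {K}.
Arguments KN {K}.

Section KroneckerForm.
Variable K : numClosedFieldType.

Definition supdiag_mx m n : 'M[K]_(m, n) :=
  \matrix_(i, j) (j == i.+1 :> nat)%:R.

Definition maindiag_mx m n : 'M[K]_(m, n) :=
  \matrix_(i, j) (j == i :> nat)%:R.

Definition kb_rows (b : kblock K) : nat :=
  match b with
  | KZero r _ => r | KL a => a | KLT a => a.+1 | KN g => g | KJ d _ => d
  end.

Definition kb_cols (b : kblock K) : nat :=
  match b with
  | KZero _ c => c | KL a => a.+1 | KLT a => a | KN g => g | KJ d _ => d
  end.

Definition kb_lead (b : kblock K) : 'M[K]_(kb_rows b, kb_cols b) :=
  match b with
  | KZero r c => 0 : 'M_(r, c)
  | KL a => supdiag_mx a a.+1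
  | KLT a => (supdiag_mx a a.+1)^T
  | KN g => 1%:M
  | KJ d z => z%:M + supdiag_mx d d
  end.

Definition kb_trail (b : kblock K) : 'M[K]_(kb_rows b, kb_cols b) :=
  match b with
  | KZero r c => 0 : 'M_(r, c)
  | KL a => maindiag_mx a a.+1
  | KLT a => (maindiag_mx a a.+1)^T
  | KN g => supdiag_mx g g
  | KJ d z => 1%:M
  end.

Fixpoint kcf_rows (s : seq (kblock K)) : nat :=
  if s is b :: s' then (kb_rows b + kcf_rows s')%N else 0%N.

Fixpoint kcf_cols (s : seq (kblock K)) : nat :=
  if s is b :: s' then (kb_cols b + kcf_cols s')%N else 0%N.

Fixpoint kcf_lead (s : seq (kblock K)) : 'M[K]_(kcf_rows s, kcf_cols s) :=
  match s with
  | [::] => 0 : 'M_(0, 0)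
  | b :: s' => block_mx (kb_lead b) 0 0 (kcf_lead s')
  end.

Fixpoint kcf_trail (s : seq (kblock K)) : 'M[K]_(kcf_rows s, kcf_cols s) :=
  match s with
  | [::] => 0 : 'M_(0, 0)
  | b :: s' => block_mx (kb_trail b) 0 0 (kcf_trail s')
  end.

(* The order of the blocks in [s] is immaterial: permuting them amounts to
   multiplying X and Y by permutation matrices. *)
Definition has_kcf k l (A B : 'M[K]_(k, l)) (s : seq (kblock K)) : Prop :=
  exists (er : kcf_rows s = k) (ec : kcf_cols s = l)
         (Y : 'M[K]_k) (X : 'M[K]_l),
    [/\ Y \in unitmx, X \in unitmx,
        Y^t* *m A *m X = castmx (er, ec) (kcf_lead s) &
        Y^t* *m B *m X = castmx (er, ec) (kcf_trail s)].

End KroneckerForm.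

Record rsvd_sizes := RsvdSizes {
  p1 : nat; p2 : nat; p3 : nat; p4 : nat; p5 : nat; p6 : nat;
  q1 : nat; q2 : nat; m3 : nat; n4 : nat }.

Section DerivedSizes.
Variable s : rsvd_sizes.

Definition q3 := p1 s.
Definition q4 := p2 s.
Definition q5 := p3 s.
Definition q6 := p4 s.
Definition m1 := p1 s.
Definition m2 := p2 s.
Definition m4 := p5 s.
Definition n1 := q2 s.
Definition n2 := p1 s.
Definition n3 := p3 s.

Definition psum := (p1 s + (p2 s + (p3 s + (p4 s + (p5 s + p6 s)))))%N.
Definition qsum := (q1 s + (q2 s + (q3 + (q4 + (q5 + q6)))))%N.
Definition msum := (m1 + (m2 + (m3 s + m4)))%N.
Definition nsum := (n1 + (n2 + (n3 + n4 s)))%N.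

End DerivedSizes.

Local Notation "M ||| N" := (row_mx M N)
  (at level 55, right associativity).
Local Notation "M === N" := (col_mx M N)
  (at level 56, right associativity).

Section SigmaBlocks.
Variables (K : numClosedFieldType) (s : rsvd_sizes).
Local Notation I := (1%:M).

Definition Sigma_alpha (a : 'rV[K]_(p1 s)) : 'M[K]_(psum s, qsum s) :=
  (0 : 'M_(p1 s, q1 s)) ||| (0 : 'M_(_, q2 s)) ||| diag_mx a
    ||| (0 : 'M_(_, q4 s)) ||| (0 : 'M_(_, q5 s)) ||| (0 : 'M_(_, q6 s)) ===
  (0 : 'M_(p2 s, _)) ||| 0 ||| 0 ||| I ||| 0 ||| 0 ===
  (0 : 'M_(p3 s, _)) ||| 0 ||| 0 ||| 0 ||| I ||| 0 ===
  (0 : 'M_(p4 s, _)) ||| 0 ||| 0 ||| 0 ||| 0 ||| I ===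
  (0 : 'M_(p5 s, _)) ||| 0 ||| 0 ||| 0 ||| 0 ||| 0 ===
  (0 : 'M_(p6 s, _)) ||| 0 ||| 0 ||| 0 ||| 0 ||| 0.

Definition Sigma_beta (b : 'rV[K]_(p1 s)) : 'M[K]_(psum s, msum s) :=
  diag_mx b          ||| (0 : 'M_(_, m2 s)) ||| (0 : 'M_(_, m3 s))
                                            ||| (0 : 'M_(_, m4 s)) ===
  (0 : 'M_(p2 s, _)) ||| I ||| 0 ||| 0 ===
  (0 : 'M_(p3 s, _)) ||| 0 ||| 0 ||| 0 ===
  (0 : 'M_(p4 s, _)) ||| 0 ||| 0 ||| 0 ===
  (0 : 'M_(p5 s, _)) ||| 0 ||| 0 ||| I ===
  (0 : 'M_(p6 s, _)) ||| 0 ||| 0 ||| 0.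

Definition Sigma_gamma (c : 'rV[K]_(p1 s)) : 'M[K]_(nsum s, qsum s) :=
  (0 : 'M_(n1 s, q1 s)) ||| I ||| (0 : 'M_(_, q3 s)) ||| (0 : 'M_(_, q4 s))
    ||| (0 : 'M_(_, q5 s)) ||| (0 : 'M_(_, q6 s)) ===
  (0 : 'M_(n2 s, _)) ||| 0 ||| diag_mx c ||| 0 ||| 0 ||| 0 ===
  (0 : 'M_(n3 s, _)) ||| 0 ||| 0 ||| 0 ||| I ||| 0 ===
  (0 : 'M_(n4 s, _)) ||| 0 ||| 0 ||| 0 ||| 0 ||| 0.

End SigmaBlocks.

Section RSVD.
Variables (R : realType) (p q m n : nat).
Variables (A : 'M[R[i]]_(p, q)) (B : 'M[R[i]]_(p, m)) (C : 'M[R[i]]_(n, q)).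

(* By the rank inequalities r_AB + r_AC <= r_ABC + r_A, r_ABC <= r_AC + r_B,
   r_ABC <= r_AB + r_C, etc., no subtraction below is truncated. *)
Definition rsvd_sizes_of : rsvd_sizes :=
  let rA := \rank A in
  let rB := \rank B in
  let rC := \rank C in
  let rAB := \rank (row_mx A B) in
  let rAC := \rank (col_mx A C) in
  let rABC := \rank (block_mx A B C 0) in
  {| p1 := (rABC + rA - (rAB + rAC))%N;
     p2 := (rAC + rB - rABC)%N;
     p3 := (rAB + rC - rABC)%N;
     p4 := (rABC - (rB + rC))%N;
     p5 := (rAB - rA)%N;
     p6 := (p - rAB)%N;
     q1 := (q - rAC)%N;
     q2 := (rAC - rA)%N;
     m3 := (m - rB)%N;
     n4 := (n - rC)%N |}.

(* The fields [rsvd_*sum] hold for all A, B, C; they only serve to give the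
   Sigma matrices the dimensions of A, B and C. *)
Record rsvd := Rsvd {
  rsvd_psum : psum rsvd_sizes_of = p;
  rsvd_qsum : qsum rsvd_sizes_of = q;
  rsvd_msum : msum rsvd_sizes_of = m;
  rsvd_nsum : nsum rsvd_sizes_of = n;
  rsvd_X : 'M[R[i]]_p;
  rsvd_Y : 'M[R[i]]_q;
  rsvd_U : 'M[R[i]]_m;
  rsvd_V : 'M[R[i]]_n;
  rsvd_alpha : 'rV[R]_(p1 rsvd_sizes_of);
  rsvd_beta : 'rV[R]_(p1 rsvd_sizes_of);
  rsvd_gamma : 'rV[R]_(p1 rsvd_sizes_of);
  rsvd_X_unit : rsvd_X \in unitmx;
  rsvd_Y_unit : rsvd_Y \in unitmx;
  rsvd_U_unitary : rsvd_U \is unitarymx;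
  rsvd_V_unitary : rsvd_V \is unitarymx;
  rsvd_alpha_gt0 : forall j, 0 < rsvd_alpha 0 j;
  rsvd_beta_gt0 : forall j, 0 < rsvd_beta 0 j;
  rsvd_gamma_gt0 : forall j, 0 < rsvd_gamma 0 j;
  rsvd_normalized : forall j,
    rsvd_alpha 0 j ^+ 2 + rsvd_beta 0 j ^+ 2 * rsvd_gamma 0 j ^+ 2 = 1;
  rsvd_factA :
    A = (invmx rsvd_X)^t*
        *m castmx (rsvd_psum, rsvd_qsum)
             (Sigma_alpha (map_mx (real_complex R) rsvd_alpha))
        *m invmx rsvd_Y;
  rsvd_factB :
    B = (invmx rsvd_X)^t*
        *m castmx (rsvd_psum, rsvd_msum)
             (Sigma_beta (map_mx (real_complex R) rsvd_beta))
        *m rsvd_U^t*;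
  rsvd_factC :
    C = rsvd_V
        *m castmx (rsvd_nsum, rsvd_qsum)
             (Sigma_gamma (map_mx (real_complex R) rsvd_gamma))
        *m invmx rsvd_Y }.

(* The finite nonzero restricted singular values. *)
Definition rsv (D : rsvd) (j : 'I_(p1 rsvd_sizes_of)) : R :=
  rsvd_alpha D 0 j / (rsvd_beta D 0 j * rsvd_gamma D 0 j).

Definition rsvd_pencil_lead : 'M[R[i]]_((p + q) + (m + n)) :=
  block_mx (block_mx 0 A (A^t*) 0) 0
           0                       (block_mx 1%:M 0 0 1%:M).

Definition rsvd_pencil_trail : 'M[R[i]]_((p + q) + (m + n)) :=
  block_mx 0                       (block_mx B 0 0 (C^t*))
           (block_mx (B^t*) 0 0 C) 0.

End RSVD.

(* Main.v *)
Require Import Defs.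
From mathcomp Require Import all_boot all_order all_algebra.
From mathcomp Require Import boolp ring zify.
Import Order.TTheory GRing.Theory Num.Theory.
Local Open Scope ring_scope.
Set Implicit Arguments.
Unset Strict Implicit.
Unset Printing Implicit Defensive.
Local Open Scope sesquilinear_scope.

(** The congruence by diag(X, Y, U, V) replaces A, B, C by the Sigma matrices
    and preserves the identity blocks since U and V are unitary. The resulting
    pencil has at most one nonzero entry per row and column of each of A, B, C,
    so permuting its rows and columns (differently) splits it into a zero
    block, copies of N_1, N_3, J_2(0), and, for each j <= p_1, a symmetric
    4 x 4 pencil whose characteristic equation is
    (lambda^2)^2 = (alpha_j / (beta_j gamma_j))^2. The latter has four distinct
    eigenvalues; its eigenvectors are orthogonal for the bilinear form given by
    the trailing matrix, which diagonalises it. Pencils are indexed by finite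
    types rather than ordinals, so that block permutations are functions
    defined by pattern matching. *)

(** * Strict equivalence of pencils indexed by finite types *)

Section StrictEquivalence.
Variable K : comNzRingType.

Definition fmul (I J H : finType) (F : I -> J -> K) (G : J -> H -> K) : I -> H -> K :=
  fun i k => \sum_j F i j * G j k.

Definition fid (I : finType) : I -> I -> K := fun i j => (i == j)%:R.

Lemma fmulA (I J H M : finType) (F : I -> J -> K) (G : J -> H -> K) (P : H -> M -> K) :
  fmul F (fmul G P) = fmul (fmul F G) P.
Proof.
apply/funext => i; apply/funext => l; rewrite /fmul.
under eq_bigr do rewrite mulr_sumr.
rewrite exchange_big; apply: eq_bigr => k _.
by rewrite mulr_suml; apply: eq_bigr => j _; rewrite mulrA.
Qed.

Lemma sum_delta (I : finType) (i : I) (f : I -> K) : \sum_j (i == j)%:R * f j = f i.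
Proof.
rewrite (bigD1 i) //= eqxx mul1r big1 ?addr0 // => j.
by rewrite eq_sym => /negbTE ->; rewrite mul0r.
Qed.

Lemma fmul1f (I J : finType) (F : I -> J -> K) : fmul (@fid I) F = F.
Proof. by apply/funext => i; apply/funext => k; apply: sum_delta. Qed.

Lemma fmulf1 (I J : finType) (F : I -> J -> K) : fmul F (@fid J) = F.
Proof.
apply/funext => i; apply/funext => k; rewrite -[RHS](sum_delta k (F i)).
by apply: eq_bigr => j _; rewrite mulrC /fid eq_sym.
Qed.

(** Rows and columns may have different index types, so both one-sided identities are demanded:
    neither implies the other without a comparison of cardinalities. *)
Definition finvertible (I J : finType) (L : I -> J -> K) :=
  exists M : J -> I -> K, fmul L M = @fid I /\ fmul M L = @fid J.

Lemma finvertible_id (I : finType) : finvertible (@fid I).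
Proof. by exists (@fid I); rewrite fmul1f. Qed.

Lemma finvertible_mul (I J H : finType) (F : I -> J -> K) (G : J -> H -> K) :
  finvertible F -> finvertible G -> finvertible (fmul F G).
Proof.
move=> [F' [FF' F'F]] [G' [GG' G'G]]; exists (fmul G' F'); split.
  by rewrite fmulA -(fmulA F) GG' fmulf1.
by rewrite fmulA -(fmulA G') F'F fmulf1.
Qed.

(** [L] carries no conjugation; [has_kcf_strict_equiv] absorbs the conjugate transpose of [has_kcf]
    by choosing [Y] to be the conjugate transpose of [L]. *)
Definition strict_equiv (I J I' J' : finType)
    (A B : I -> J -> K) (A' B' : I' -> J' -> K) :=
  exists (L : I' -> I -> K) (R : J -> J' -> K),
    [/\ finvertible L, finvertible R,
        A' = fmul (fmul L A) R & B' = fmul (fmul L B) R].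

Lemma strict_equiv_refl (I J : finType) (A B : I -> J -> K) : strict_equiv A B A B.
Proof.
exists (@fid I), (@fid J); split; rewrite ?fmul1f ?fmulf1 //; exact: finvertible_id.
Qed.

Lemma strict_equiv_trans (I J I' J' I'' J'' : finType) (A B : I -> J -> K)
    (A' B' : I' -> J' -> K) (A'' B'' : I'' -> J'' -> K) :
  strict_equiv A B A' B' -> strict_equiv A' B' A'' B'' -> strict_equiv A B A'' B''.
Proof.
move=> [L [R [iL iR -> ->]]] [L' [R' [iL' iR' -> ->]]].
exists (fmul L' L), (fmul R R'); split; try exact: finvertible_mul.
  by rewrite !fmulA.
by rewrite !fmulA.
Qed.

Lemma strict_equiv_sym (I J I' J' : finType) (A B : I -> J -> K) (A' B' : I' -> J' -> K) :
  strict_equiv A B A' B' -> strict_equiv A' B' A B.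
Proof.
move=> [L [R [[L' [LL' L'L]] [R' [RR' R'R]] -> ->]]].
exists L', R'; split; [by exists L | by exists R | |].
  by rewrite !fmulA L'L fmul1f -fmulA RR' fmulf1.
by rewrite !fmulA L'L fmul1f -fmulA RR' fmulf1.
Qed.

Lemma finvertible_bij (I J : finType) (f : I -> J) :
  bijective f -> finvertible (fun i j => (f i == j)%:R).
Proof.
move=> [g fK gK]; exists (fun j i => (g j == i)%:R); split.
  apply/funext => i; apply/funext => k.
  by rewrite /fmul (sum_delta (f i) (fun j => (g j == k)%:R)) fK.
apply/funext => i; apply/funext => k.
by rewrite /fmul (sum_delta (g i) (fun j => (f j == k)%:R)) gK.
Qed.

(** [L] and [R] are the permutation matrices of [f] and of the inverse of [g]. Both maps send new
    indices to old ones, and they are independent of each other. *)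
Lemma strict_equiv_reindex (I J I' J' : finType) (f : I' -> I) (g : J' -> J)
    (A B : I -> J -> K) (A' B' : I' -> J' -> K) :
  bijective f -> bijective g ->
  (forall i j, A' i j = A (f i) (g j)) -> (forall i j, B' i j = B (f i) (g j)) ->
  strict_equiv A B A' B'.
Proof.
move=> bf bg eA eB.
have [/finvertible_bij iL [g' gK g'K]] := (bf, bg).
have E (C : I -> J -> K) (C' : I' -> J' -> K) : (forall i j, C' i j = C (f i) (g j)) ->
    C' = fmul (fmul (fun i j => (f i == j)%:R) C) (fun j i => (g' j == i)%:R).
  move=> eC; apply/funext => i; apply/funext => j; rewrite eC /fmul.
  under eq_bigr => k _ do rewrite (sum_delta (f i) (fun l => C l k)) mulrC.
  rewrite -(sum_delta (g j) (C (f i))); apply: eq_bigr => k _.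
  by rewrite (can2_eq gK g'K) eq_sym.
exists (fun i j => (f i == j)%:R), (fun j i => (g' j == i)%:R); split => //.
- by apply: finvertible_bij; exists g.
- exact: E.
- exact: E.
Qed.

Definition dsum (I J I' J' : finType) (A : I -> J -> K) (A' : I' -> J' -> K)
    (i : I + I') (j : J + J') : K :=
  match i, j with
  | inl i, inl j => A i j
  | inr i, inr j => A' i j
  | _, _ => 0
  end.

Lemma fmul_dsum (I J H I' J' H' : finType) (F : I -> J -> K) (G : J -> H -> K)
    (F' : I' -> J' -> K) (G' : J' -> H' -> K) :
  fmul (dsum F F') (dsum G G') = dsum (fmul F G) (fmul F' G').
Proof.
apply/funext => -[i|i]; apply/funext => -[k|k]; rewrite /fmul big_sumType /=.
- by rewrite [X in _ + X]big1 ?addr0 // => j _; rewrite mul0r.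
- by rewrite !big1 ?addr0 // => j _; rewrite ?mul0r ?mulr0.
- by rewrite !big1 ?addr0 // => j _; rewrite ?mul0r ?mulr0.
- by rewrite [X in X + _]big1 ?add0r // => j _; rewrite mul0r.
Qed.

Lemma dsum_fid (I I' : finType) : dsum (@fid I) (@fid I') = @fid (I + I')%type.
Proof. by apply/funext => -[i|i]; apply/funext => -[k|k]. Qed.

Lemma finvertible_dsum (I J I' J' : finType) (F : I -> J -> K) (G : I' -> J' -> K) :
  finvertible F -> finvertible G -> finvertible (dsum F G).
Proof.
move=> [F' [FF' F'F]] [G' [GG' G'G]]; exists (dsum F' G').
by rewrite !fmul_dsum FF' F'F GG' G'G !dsum_fid.
Qed.

Lemma strict_equiv_dsum (I1 J1 I1' J1' I2 J2 I2' J2' : finType)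
    (A1 B1 : I1 -> J1 -> K) (A1' B1' : I1' -> J1' -> K)
    (A2 B2 : I2 -> J2 -> K) (A2' B2' : I2' -> J2' -> K) :
  strict_equiv A1 B1 A1' B1' -> strict_equiv A2 B2 A2' B2' ->
  strict_equiv (dsum A1 A2) (dsum B1 B2) (dsum A1' A2') (dsum B1' B2').
Proof.
move=> [L [R [iL iR -> ->]]] [L' [R' [iL' iR' -> ->]]].
exists (dsum L L'), (dsum R R').
by split; rewrite ?fmul_dsum //; apply: finvertible_dsum.
Qed.

(** All blocks have the same shape, so that the index type is a plain product and not a dependent
    sum. *)
Definition dfam (n : nat) (I J : finType) (A : 'I_n -> I -> J -> K)
    (i : 'I_n * I) (j : 'I_n * J) : K :=
  if i.1 == j.1 then A i.1 i.2 j.2 else 0.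

Definition fam_split n (I : Type) (x : I + 'I_n * I) : 'I_n.+1 * I :=
  match x with inl i => (ord0, i) | inr (k, i) => (lift ord0 k, i) end.

Lemma fam_split_bij n I : bijective (@fam_split n I).
Proof.
exists (fun x : 'I_n.+1 * I =>
          if unlift ord0 x.1 is Some k then inr (k, x.2) else inl x.2).
  by case=> [i|[k i]] /=; rewrite ?unlift_none ?liftK.
by case=> k i /=; case: unliftP => [j|] ->.
Qed.

(** Separating copy [ord0] from the others is what drives the induction on the number of copies in
    [to_kcf_dfam]. *)
Lemma strict_equiv_dfamS n (I J : finType) (A B : 'I_n.+1 -> I -> J -> K) :
  strict_equiv (dfam A) (dfam B)
    (dsum (A ord0) (dfam (fun k => A (lift ord0 k))))
    (dsum (B ord0) (dfam (fun k => B (lift ord0 k)))).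
Proof.
apply: (strict_equiv_reindex (@fam_split_bij n I) (@fam_split_bij n J)).
  by move=> [i|[k i]] [j|[l j]].
by move=> [i|[k i]] [j|[l j]].
Qed.

End StrictEquivalence.

(** * Bijections that split ordinals, drop empty summands or reassociate sums *)

Lemma unsplit_bij m n : bijective (@unsplit m n).
Proof. by exists (@split m n); [apply: unsplitK | apply: splitK]. Qed.

Definition of_ord0 (T : Type) (i : 'I_0) : T :=
  match notF (valP i) with end.

Lemma inl_bij0 (T : Type) : bijective (@inl T 'I_0).
Proof.
by exists (fun x => match x with inl y => y | inr i => of_ord0 T i end) => // -[|[]].
Qed.

Lemma inr_bij0 (T : Type) : bijective (@inr 'I_0 T).
Proof.
by exists (fun x => match x with inl i => of_ord0 T i | inr y => y end) => // -[[]|].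
Qed.

Definition sum_assoc (T1 T2 T3 : Type) (x : T1 + (T2 + T3)) : T1 + T2 + T3 :=
  match x with
  | inl i => inl (inl i)
  | inr (inl i) => inl (inr i)
  | inr (inr i) => inr i
  end.

Lemma sum_assoc_bij (T1 T2 T3 : Type) : bijective (@sum_assoc T1 T2 T3).
Proof.
exists (fun x => match x with
  | inl (inl i) => inl i | inl (inr i) => inr (inl i) | inr i => inr (inr i) end).
  by case=> [|[]].
by case=> [[]|].
Qed.

(** * From strict equivalence to the Kronecker canonical form of matrices *)

Section MatrixPencils.
Variable K : numClosedFieldType.

Lemma fmul_mx k l r (A : 'M[K]_(k, l)) (B : 'M[K]_(l, r)) :
  fmul A B = A *m B :> (_ -> _ -> _).
Proof. by apply/funext => i; apply/funext => j; rewrite mxE. Qed.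

Lemma fid_mx k : @fid K 'I_k = 1%:M :> (_ -> _ -> _).
Proof. by apply/funext => i; apply/funext => j; rewrite mxE. Qed.

Lemma strict_equiv_mx k l (L : 'M[K]_k) (R : 'M[K]_l) (A B : 'M_(k, l)) :
  L \in unitmx -> R \in unitmx ->
  strict_equiv A B (L *m A *m R) (L *m B *m R).
Proof.
move=> uL uR; exists L, R; split; rewrite ?fmul_mx //.
  by exists (invmx L); rewrite !fmul_mx mulmxV ?mulVmx // fid_mx.
by exists (invmx R); rewrite !fmul_mx mulmxV ?mulVmx // fid_mx.
Qed.

Lemma fun_mx k l (F : 'I_k -> 'I_l -> K) :
  F = (\matrix_(i, j) F i j) :> (_ -> _ -> _).
Proof. by apply/funext => i; apply/funext => j; rewrite mxE. Qed.

(** A product equal to an identity matrix bounds its size by the inner dimension; applied to both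
    one-sided identities, this forces equality. The result supplies the dimension equations that
    [has_kcf] asks for. *)
Lemma finvertible_dim m n (L : 'I_m -> 'I_n -> K) : finvertible L -> m = n.
Proof.
have le a b (F : 'I_a -> 'I_b -> K) G : fmul F G = @fid _ _ -> (a <= b)%N.
  rewrite (fun_mx F) (fun_mx G) fmul_mx fid_mx => e.
  by apply: mulmx1_min; apply/matrixP => i j; exact: (congr1 (fun f => f i j) e).
by move=> [M [/le mn /le nm]]; apply/eqP; rewrite eqn_leq mn.
Qed.

Lemma has_kcf_strict_equiv k l (A B : 'M[K]_(k, l)) (s : seq (kblock K)) :
  strict_equiv A B (kcf_lead s) (kcf_trail s) -> has_kcf A B s.
Proof.
move=> [L [R [iL iR eA eB]]].
have er := finvertible_dim iL; have ec := esym (finvertible_dim iR).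
(* Eliminating both dimension equations turns the casts into identities and makes [L] and [R]
   square. *)
exists er, ec; case: _ / er A B L iL eA eB => A.
case: _ / ec A R iR => A R iR B L iL eA eB.
pose ML : 'M_(kcf_rows s) := \matrix_(i, j) L i j.
pose MR : 'M_(kcf_cols s) := \matrix_(i, j) R i j.
have unit n (F : 'M[K]_n) : finvertible F -> F \in unitmx.
  move=> [G [+ _]]; rewrite (fun_mx G) fmul_mx fid_mx => e.
  suff /mulmx1_unit[] : F *m (\matrix_(i, j) G i j) = 1%:M by [].
  by apply/matrixP => i j; exact: (congr1 (fun f => f i j) e).
rewrite (fun_mx L) in iL eA eB; rewrite (fun_mx R) in iR eA eB.
exists (ML^t*), MR; rewrite !castmx_id trmxCK; split.
- by rewrite map_unitmx unitmx_tr unit.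
- exact: unit.
- by apply/matrixP => i j; rewrite eA !fmul_mx.
- by apply/matrixP => i j; rewrite eB !fmul_mx.
Qed.

Lemma strict_equiv_block k1 l1 k2 l2 (A1 B1 : 'M[K]_(k1, l1)) (A2 B2 : 'M[K]_(k2, l2)) :
  strict_equiv (block_mx A1 0 0 A2) (block_mx B1 0 0 B2) (dsum A1 A2) (dsum B1 B2).
Proof.
apply: (strict_equiv_reindex (unsplit_bij k1 k2) (unsplit_bij l1 l2)).
  by case=> i [] j /=; rewrite ?(block_mxEul, block_mxEur, block_mxEdl, block_mxEdr) ?mxE.
by case=> i [] j /=; rewrite ?(block_mxEul, block_mxEur, block_mxEdl, block_mxEdr) ?mxE.
Qed.

(** Unlike [has_kcf], this is free of dimension casts and allows any index types, hence it combines
    directly with sums and reindexing. *)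
Definition to_kcf (I J : finType) (A B : I -> J -> K) (s : seq (kblock K)) :=
  strict_equiv A B (kcf_lead s) (kcf_trail s).

(** Induction on [s]: the head block is split off, the sum is reassociated, and the induction
    hypothesis is applied to the canonical tail itself. For empty [s] the canonical form is 0 x 0,
    so [inr] is a bijection. *)
Lemma to_kcf_dsum (I J I' J' : finType) (A B : I -> J -> K) (A' B' : I' -> J' -> K) s s' :
  to_kcf A B s -> to_kcf A' B' s' -> to_kcf (dsum A A') (dsum B B') (s ++ s').
Proof.
elim: s I J A B => [|b s IHs] I J A B As As'.
  apply: strict_equiv_trans (strict_equiv_dsum As As') _.
  apply: (@strict_equiv_reindex _ _ _ _ _ inr inr); try by [].
    exact: inr_bij0.
  exact: inr_bij0.
apply: strict_equiv_trans (strict_equiv_dsum As (strict_equiv_refl _ _)) _.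
apply: strict_equiv_trans
  (strict_equiv_dsum (strict_equiv_block _ _ _ _) (strict_equiv_refl _ _)) _.
apply: strict_equiv_trans (strict_equiv_sym (strict_equiv_block _ _ _ _)).
apply: strict_equiv_trans (strict_equiv_dsum (strict_equiv_refl _ _)
  (IHs _ _ _ _ (strict_equiv_refl _ _) As')).
apply: (strict_equiv_reindex (@sum_assoc_bij _ _ _) (@sum_assoc_bij _ _ _)).
  by case=> [?|[?|?]] [?|[?|?]].
by case=> [?|[?|?]] [?|[?|?]].
Qed.

(** The canonical form of a one-element list still carries a 0 x 0 corner, which [inl] accounts
    for. *)
Lemma to_kcf1 (b : kblock K) : to_kcf (kb_lead b) (kb_trail b) [:: b].
Proof.
apply: strict_equiv_trans (strict_equiv_sym (strict_equiv_block _ _ _ _)).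
apply: (@strict_equiv_sym _ _ _ _ _ _ _ (kb_lead b) (kb_trail b)).
apply: (@strict_equiv_reindex _ _ _ _ _ inl inl); try by [].
  exact: inl_bij0.
exact: inl_bij0.
Qed.

Lemma to_kcf_dfam n (I J : finType) (A B : 'I_n -> I -> J -> K)
    (s : 'I_n -> seq (kblock K)) :
  (forall k, to_kcf (A k) (B k) (s k)) ->
  to_kcf (dfam A) (dfam B) (flatten [seq s k | k <- enum 'I_n]).
Proof.
elim: n A B s => [|n IHn] A B s As.
  have -> : enum 'I_0 = [::] by apply: size0nil; rewrite size_enum_ord.
  have bij0 (T : Type) : bijective (fun i => of_ord0 ('I_0 * T) i).
    by exists fst => -[] [].
  by apply: (strict_equiv_reindex (bij0 I) (bij0 J)) => -[].
apply: strict_equiv_trans (strict_equiv_dfamS _ _) _.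
by rewrite enum_ordSl /= -map_comp; apply: to_kcf_dsum => //; apply: IHn.
Qed.

Lemma to_kcf_dfam_const n (b : kblock K) :
  to_kcf (dfam (fun _ : 'I_n => kb_lead b)) (dfam (fun _ : 'I_n => kb_trail b))
    (nseq n b).
Proof.
have := @to_kcf_dfam n _ _ _ _ (fun=> [:: b]) (fun _ => to_kcf1 b).
congr to_kcf; rewrite -[in RHS](size_enum_ord n).
by elim: (enum 'I_n) => //= k e ->.
Qed.

End MatrixPencils.

(** * The 4 x 4 pencil attached to one triplet of positive restricted values *)

Section Quad.
Variable K : numClosedFieldType.

Lemma to_kcf_diag n (z : 'rV[K]_n) :
  to_kcf (diag_mx z) (1%:M : 'M[K]_n) (flatten [seq [:: KJ 1 (z 0 k)] | k <- enum 'I_n]).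
Proof.
apply: strict_equiv_trans _
  (@to_kcf_dfam _ n 'I_1 'I_1 _ _ _ (fun k => to_kcf1 (KJ 1 (z 0 k)))).
have bij1 : bijective (fun x : 'I_n * 'I_1 => x.1).
  by exists (fun i => (i, ord0)) => // -[i j] /=; rewrite [j]ord1.
apply: (strict_equiv_reindex bij1 bij1) => -[i i'] [j j']; rewrite /dfam /= !mxE /=.
  by rewrite !ord1; case: eqVneq => [->|_]; rewrite ?mulr1n ?addr0 ?mulr0n.
by rewrite !ord1; case: eqVneq.
Qed.

Definition mx4 (rows : seq (seq K)) : 'M[K]_4 :=
  \matrix_(i, j) nth 0 (nth [::] rows i) j.

(** The part of the pencil of the Sigma matrices at one index [j]; the coordinates come from the
    blocks of sizes [p1], [q3], [m1] and [n2], in this order. *)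
Definition quad_lead (a : K) := mx4
  [:: [:: 0; a; 0; 0]; [:: a; 0; 0; 0]; [:: 0; 0; 1; 0]; [:: 0; 0; 0; 1]].

Definition quad_trail (b c : K) := mx4
  [:: [:: 0; 0; b; 0]; [:: 0; 0; 0; c]; [:: b; 0; 0; 0]; [:: 0; c; 0; 0]].

(** The columns of [X] are eigenvectors that are orthogonal for the bilinear form of [T]. Since [d]
    has no zero entry, [X] is invertible, and the transforming matrices are [diag_mx d' *m X^T] and
    [X]. *)
Lemma strict_equiv_diagonalise n (A T X : 'M[K]_n) (z d : 'rV[K]_n) :
  (forall k, d 0 k != 0) -> A *m X = T *m X *m diag_mx z ->
  X^T *m T *m X = diag_mx d -> strict_equiv A T (diag_mx z) (1%:M : 'M_n).
Proof.
move=> d0 eA eT; pose d' := map_mx (fun x => x^-1) d.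
have d'd : diag_mx d' *m diag_mx d = 1%:M.
  rewrite mulmx_diag -diag_const_mx; congr diag_mx; apply/rowP => j.
  by rewrite !mxE mulVf.
have ud : diag_mx d \in unitmx by case: (mulmx1_unit d'd).
have uX : X \in unitmx by move: ud; rewrite -eT unitmx_mul => /andP[].
have {eA} eA : diag_mx d' *m X^T *m A *m X = diag_mx z.
  by rewrite -mulmxA eA !mulmxA -(mulmxA _ X^T) -(mulmxA (diag_mx d')) eT d'd mul1mx.
have {eT} eT : diag_mx d' *m X^T *m T *m X = 1%:M.
  by rewrite -!mulmxA (mulmxA X^T) eT.
rewrite -eA -eT; apply: strict_equiv_mx => //.
by rewrite unitmx_mul unitmx_tr uX andbT; case: (mulmx1_unit d'd).
Qed.

Lemma to_kcf_quad (a b c l : K) : a != 0 -> b != 0 -> c != 0 -> l ^+ 2 = a / (b * c) ->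
  to_kcf (quad_lead a) (quad_trail b c)
    [:: KJ 1 l; KJ 1 (- l); KJ 1 ('i * l); KJ 1 (- 'i * l)].
Proof.
move=> a0 b0 c0 el.
(* Eliminating [a] in favour of [l] makes the later checks polynomial identities modulo
   ['i ^+ 2 = -1]. *)
have {}el : a = l ^+ 2 * b * c by rewrite el -mulrA divfK ?mulf_neq0.
have l0 : l != 0 by apply: contraNneq a0 => l0; rewrite el l0 expr0n !mul0r.
have i2 := sqrCi K.
(* The eigenvector for z, with z ^ 2 = e a / (b c) and e = 1 or -1, is
   (e c, b, e z b c, z b c). *)
pose z := [:: l; - l; 'i * l; - 'i * l]; pose e := [:: 1; 1; -1; -1] : seq K.
pose X := mx4 [:: [seq x * c | x <- e]; nseq 4 b;
  [seq x.1 * x.2 * b * c | x <- zip e z]; [seq x * b * c | x <- z]].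
have -> : [:: KJ 1 l; KJ 1 (- l); KJ 1 ('i * l); KJ 1 (- 'i * l)] =
    flatten [seq [:: KJ 1 ((\row_(k < 4) z`_k) 0 k)] | k <- enum 'I_4].
  by rewrite !enum_ordSl /= !mxE (size0nil (size_enum_ord 0)).
apply: strict_equiv_trans _ (to_kcf_diag _).
(* Columns with parameters e, z and e', z' pair under the trailing matrix to b^2 c^2 (z + z') (1 + e
   e'). Distinct columns have e' = - e or z' = - z, which gives 0; a column paired with itself gives
   4 z b^2 c^2. *)
apply: (@strict_equiv_diagonalise _ _ _ X _ (\row_k (4 * z`_k * b ^+ 2 * c ^+ 2))).
- case=> [[|[|[|[|//]]]] lk]; rewrite ?mxE /=
    ?(mulf_neq0, expf_neq0, oppr_eq0, neq0Ci, pnatr_eq0) //.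
- rewrite el; apply/matrixP => -[[|[|[|[|//]]]] li] [[|[|[|[|//]]]] lj];
  rewrite mul_mx_diag !mxE !big_ord_recl !big_ord0 !mxE /=; ring: i2.
- apply/matrixP => -[[|[|[|[|//]]]] li] [[|[|[|[|//]]]] lj];
  rewrite !mxE !big_ord_recl !big_ord0 !mxE !big_ord_recl !big_ord0 !mxE /=
    -?val_eqE /= ?mulr1n ?mulr0n; ring: i2.
Qed.
End Quad.

Definition sum_map (S S' T T' : Type) (f : S -> T) (g : S' -> T') (x : S + S') : T + T' :=
  match x with inl y => inl (f y) | inr y => inr (g y) end.

Lemma sum_map_bij (S S' T T' : Type) (f : S -> T) (g : S' -> T') :
  bijective f -> bijective g -> bijective (sum_map f g).
Proof.
move=> [f' fK f'K] [g' gK g'K].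
by exists (sum_map f' g'); case=> x /=; rewrite ?fK ?f'K ?gK ?g'K.
Qed.

(** * Effect of the RSVD factors and of dimension casts on the pencil *)

Section Congruence.
Variables (R : realType) (p q m n : nat).
Local Notation C := R[i].
Implicit Types (A : 'M[C]_(p, q)) (B : 'M[C]_(p, m)) (G : 'M[C]_(n, q)).

Lemma pencil_congr A B G (X : 'M_p) (Y : 'M_q) (U : 'M_m) (V : 'M_n) :
  X \in unitmx -> Y \in unitmx -> U \is unitarymx -> V \is unitarymx ->
  strict_equiv (rsvd_pencil_lead m n A) (rsvd_pencil_trail B G)
    (rsvd_pencil_lead m n (X^t* *m A *m Y))
    (rsvd_pencil_trail (X^t* *m B *m U) (V^t* *m G *m Y)).
Proof.
move=> uX uY uU uV.
pose D := block_mx (block_mx X 0 0 Y) 0 0 (block_mx U 0 0 V).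
have eD : D^t* = block_mx (block_mx (X^t*) 0 0 (Y^t*)) 0 0 (block_mx (U^t*) 0 0 (V^t*)).
  by rewrite !(tr_block_mx, map_block_mx, trmx0, map_mx0).
have uD : D \in unitmx.
  by rewrite unitmxE !det_ublock !unitrM -!unitmxE uX uY !unitarymx_unit.
have UU : U^t* *m U = 1%:M by apply/mulmx1C/unitarymxP.
have VV : V^t* *m V = 1%:M by apply/mulmx1C/unitarymxP.
have -> : rsvd_pencil_lead m n (X^t* *m A *m Y) = D^t* *m rsvd_pencil_lead m n A *m D.
  rewrite eD /rsvd_pencil_lead !(mulmx_block, mulmx0, mul0mx, addr0, add0r, mulmx1).
  by rewrite UU VV !(trmx_mul, map_mxM) trmxCK mulmxA.
have -> : rsvd_pencil_trail (X^t* *m B *m U) (V^t* *m G *m Y) =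
    D^t* *m rsvd_pencil_trail B G *m D.
  rewrite eD /rsvd_pencil_trail !(mulmx_block, mulmx0, mul0mx, addr0, add0r, mulmx1).
  by rewrite !(trmx_mul, map_mxM) !trmxCK !mulmxA.
by apply: strict_equiv_mx; rewrite // map_unitmx unitmx_tr.
Qed.

(** With dimensions that are independent variables, the size equations can be eliminated. Those of
    an RSVD cannot be eliminated in place: their left sides depend on matrices whose dimensions are
    the right sides. *)
Lemma pencil_cast p' q' m' n' (ep : p' = p) (eq : q' = q) (em : m' = m) (en : n' = n)
    (A : 'M[C]_(p', q')) (B : 'M[C]_(p', m')) (G : 'M[C]_(n', q')) :
  strict_equiv
    (rsvd_pencil_lead m n (castmx (ep, eq) A))
    (rsvd_pencil_trail (castmx (ep, em) B) (castmx (en, eq) G))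
    (rsvd_pencil_lead m' n' A) (rsvd_pencil_trail B G).
Proof.
case: _ / ep; case: _ / eq; case: _ / em; case: _ / en.
by rewrite !castmx_id; apply: strict_equiv_refl.
Qed.

End Congruence.

(** * Indices of the Sigma matrices as sums of block indices *)

Definition ord6 k1 k2 k3 k4 k5 k6 :
    'I_k1 + ('I_k2 + ('I_k3 + ('I_k4 + ('I_k5 + 'I_k6)))) ->
    'I_(k1 + (k2 + (k3 + (k4 + (k5 + k6)))))%N :=
  @unsplit _ _ \o sum_map id (@unsplit _ _ \o sum_map id (@unsplit _ _ \o
   sum_map id (@unsplit _ _ \o sum_map id (@unsplit _ _)))).

Definition ord4 k1 k2 k3 k4 :
    'I_k1 + ('I_k2 + ('I_k3 + 'I_k4)) -> 'I_(k1 + (k2 + (k3 + k4)))%N :=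
  @unsplit _ _ \o sum_map id (@unsplit _ _ \o sum_map id (@unsplit _ _)).

Arguments ord6 : simpl never.
Arguments ord4 : simpl never.

Lemma id_bij (T : Type) : bijective (@id T).
Proof. by exists id. Qed.

Lemma ord6_bij k1 k2 k3 k4 k5 k6 : bijective (@ord6 k1 k2 k3 k4 k5 k6).
Proof.
by do !(apply: bij_comp (unsplit_bij _ _) (sum_map_bij (@id_bij _) _));
  apply: unsplit_bij.
Qed.

Lemma ord4_bij k1 k2 k3 k4 : bijective (@ord4 k1 k2 k3 k4).
Proof.
by do !(apply: bij_comp (unsplit_bij _ _) (sum_map_bij (@id_bij _) _));
  apply: unsplit_bij.
Qed.

(** * The pencil of the Sigma matrices, entry by entry *)

Section SigmaPencil.
Variables (R : realType) (s : rsvd_sizes).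
Local Notation C := R[i].
Variables a b c : 'rV[C]_(p1 s).
Hypothesis aJ : forall j, (a 0 j)^* = a 0 j.
Hypothesis bJ : forall j, (b 0 j)^* = b 0 j.
Hypothesis cJ : forall j, (c 0 j)^* = c 0 j.

Definition P_index : finType :=
  ('I_(p1 s) + ('I_(p2 s) + ('I_(p3 s) + ('I_(p4 s) + ('I_(p5 s) + 'I_(p6 s))))))%type.
Definition Q_index : finType :=
  ('I_(q1 s) + ('I_(q2 s) + ('I_(q3 s) + ('I_(q4 s) + ('I_(q5 s) + 'I_(q6 s))))))%type.
Definition M_index : finType := ('I_(m1 s) + ('I_(m2 s) + ('I_(m3 s) + 'I_(m4 s))))%type.
Definition N_index : finType := ('I_(n1 s) + ('I_(n2 s) + ('I_(n3 s) + 'I_(n4 s))))%type.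
Definition pencil_index : finType := ((P_index + Q_index) + (M_index + N_index))%type.

Local Notation B1 x := (inl x).
Local Notation B2 x := (inr (inl x)).
Local Notation B3 x := (inr (inr (inl x))).
Local Notation B4 x := (inr (inr (inr (inl x)))).
Local Notation B5 x := (inr (inr (inr (inr (inl x))))).
Local Notation B6 x := (inr (inr (inr (inr (inr x))))).
Local Notation E4 x := (inr (inr (inr x))).

(** The indices may come from different blocks, such as those of sizes [p1 s] and [q3 s]; these
    sizes are convertible, so [i == j] makes sense. *)
Definition ifeq n (i j : 'I_n) (x : C) := if i == j then x else 0.

Definition alpha_entry (x : P_index) (y : Q_index) : C :=
  match x, y with
  | B1 i, B3 j => ifeq i j (a 0 i)
  | B2 i, B4 j => ifeq i j 1
  | B3 i, B5 j => ifeq i j 1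
  | B4 i, B6 j => ifeq i j 1
  | _, _ => 0
  end.

Definition beta_entry (x : P_index) (y : M_index) : C :=
  match x, y with
  | B1 i, B1 j => ifeq i j (b 0 i)
  | B2 i, B2 j => ifeq i j 1
  | B5 i, E4 j => ifeq i j 1
  | _, _ => 0
  end.

Definition gamma_entry (x : N_index) (y : Q_index) : C :=
  match x, y with
  | B1 i, B2 j => ifeq i j 1
  | B2 i, B3 j => ifeq i j (c 0 i)
  | B3 i, B5 j => ifeq i j 1
  | _, _ => 0
  end.

Lemma Sigma_alphaE x y : Sigma_alpha a (ord6 x) (ord6 y) = alpha_entry x y.
Proof.
case: x => [i|[i|[i|[i|[i|i]]]]]; case: y => [j|[j|[j|[j|[j|j]]]]];
  rewrite /ord6 /ord4 /= ?(row_mxEl, row_mxEr, col_mxEu, col_mxEd) mxE //= /ifeq;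
  by case: eqVneq.
Qed.

Lemma Sigma_betaE x y : Sigma_beta b (ord6 x) (ord4 y) = beta_entry x y.
Proof.
case: x => [i|[i|[i|[i|[i|i]]]]]; case: y => [j|[j|[j|j]]];
  rewrite /ord6 /ord4 /= ?(row_mxEl, row_mxEr, col_mxEu, col_mxEd) mxE //= /ifeq;
  by case: eqVneq.
Qed.

Lemma Sigma_gammaE x y : Sigma_gamma c (ord4 x) (ord6 y) = gamma_entry x y.
Proof.
case: x => [i|[i|[i|i]]]; case: y => [j|[j|[j|[j|[j|j]]]]];
  rewrite /ord6 /ord4 /= ?(row_mxEl, row_mxEr, col_mxEu, col_mxEd) mxE //= /ifeq;
  by case: eqVneq.
Qed.

(** The quadrant of [A^*] carries no conjugation because the Sigma matrices have real entries;
    [alpha_entryJ] reconciles the two in [strict_equiv_entries]. *)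
Definition lead_entry (x y : pencil_index) : C :=
  match x, y with
  | inl (inl i), inl (inr j) => alpha_entry i j
  | inl (inr j), inl (inl i) => alpha_entry i j
  | inr i, inr j => (i == j)%:R
  | _, _ => 0
  end.

Definition trail_entry (x y : pencil_index) : C :=
  match x, y with
  | inl (inl i), inr (inl j) => beta_entry i j
  | inr (inl j), inl (inl i) => beta_entry i j
  | inl (inr j), inr (inr i) => gamma_entry i j
  | inr (inr i), inl (inr j) => gamma_entry i j
  | _, _ => 0
  end.

Lemma ifeqC n (i j : 'I_n) x : ifeq i j x = ifeq j i x.
Proof. by rewrite /ifeq eq_sym. Qed.

Lemma ifeq_rowC n (i j : 'I_n) (x : 'rV_n) : ifeq i j (x 0 i) = ifeq j i (x 0 j).
Proof. by rewrite /ifeq; case: eqVneq => [->|]. Qed.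

Lemma ifeq1 n (i j : 'I_n) : (i == j)%:R = ifeq i j 1.
Proof. by rewrite /ifeq; case: eqP. Qed.

Lemma ifeqJ n (i j : 'I_n) x : x^* = x -> (ifeq i j x)^* = ifeq i j x.
Proof. by rewrite /ifeq; case: eqP => //; rewrite conjC0. Qed.

Lemma alpha_entryJ x y : (alpha_entry x y)^* = alpha_entry x y.
Proof.
by case: x => [i|[i|[i|[i|[i|i]]]]]; case: y => [j|[j|[j|[j|[j|j]]]]];
  rewrite /= ?conjC0 // ifeqJ ?conjC1.
Qed.

Lemma beta_entryJ x y : (beta_entry x y)^* = beta_entry x y.
Proof.
by case: x => [i|[i|[i|[i|[i|i]]]]]; case: y => [j|[j|[j|j]]];
  rewrite /= ?conjC0 // ifeqJ ?conjC1.
Qed.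

Lemma gamma_entryJ x y : (gamma_entry x y)^* = gamma_entry x y.
Proof.
by case: x => [i|[i|[i|i]]]; case: y => [j|[j|[j|[j|[j|j]]]]];
  rewrite /= ?conjC0 // ifeqJ ?conjC1.
Qed.

Lemma strict_equiv_entries :
  strict_equiv
    (rsvd_pencil_lead (msum s) (nsum s) (Sigma_alpha a))
    (rsvd_pencil_trail (Sigma_beta b) (Sigma_gamma c))
    lead_entry trail_entry.
Proof.
pose f : pencil_index ->
    'I_((psum s + qsum s) + (msum s + nsum s)) :=
  @unsplit _ _ \o sum_map
    (@unsplit _ _ \o sum_map (@ord6 _ _ _ _ _ _) (@ord6 _ _ _ _ _ _))
    (@unsplit _ _ \o sum_map (@ord4 _ _ _ _) (@ord4 _ _ _ _)).
have f_bij : bijective f.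
  apply: bij_comp (unsplit_bij _ _) (sum_map_bij _ _);
    apply: bij_comp (unsplit_bij _ _) (sum_map_bij _ _);
    do ?[exact: ord6_bij | exact: ord4_bij].
have blockE := (block_mxEul, block_mxEur, block_mxEdl, block_mxEdr).
apply: (strict_equiv_reindex f_bij f_bij).
  case=> [[x|x]|[x|x]] [[y|y]|[y|y]]; rewrite /f /= !blockE; try by rewrite mxE.
  - by rewrite Sigma_alphaE.
  - by rewrite 2!mxE Sigma_alphaE alpha_entryJ.
  - by rewrite mxE (inj_eq (bij_inj (ord4_bij _ _ _ _))).
  - by rewrite mxE (inj_eq (bij_inj (ord4_bij _ _ _ _))).
case=> [[x|x]|[x|x]] [[y|y]|[y|y]]; rewrite /f /= !blockE; try by rewrite mxE.
- by rewrite Sigma_betaE.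
- by rewrite 2!mxE Sigma_gammaE gamma_entryJ.
- by rewrite 2!mxE Sigma_betaE beta_entryJ.
- by rewrite Sigma_gammaE.
Qed.

(** * Permutation of the rows and columns into canonical blocks *)

Definition block_index : finType :=
  ('I_(p6 s + q1 s) +
   (('I_(p4 s) * 'I_1 + 'I_(q6 s) * 'I_1 + 'I_(m3 s) * 'I_1 + 'I_(n4 s) * 'I_1) +
    ('I_(p2 s) * 'I_3 + ('I_(p3 s) * 'I_3 +
     (('I_(p5 s) * 'I_2 + 'I_(q2 s) * 'I_2) + 'I_(p1 s) * 'I_4)))))%type.

Local Notation Z0 x := (inl x).
Local Notation Np4 x := (inr (inl (inl (inl (inl x))))).
Local Notation Nq6 x := (inr (inl (inl (inl (inr x))))).
Local Notation Nm3 x := (inr (inl (inl (inr x)))).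
Local Notation Nn4 x := (inr (inl (inr x))).
Local Notation Np2 x := (inr (inr (inl x))).
Local Notation Np3 x := (inr (inr (inr (inl x)))).
Local Notation Jp5 x := (inr (inr (inr (inr (inl (inl x)))))).
Local Notation Jq2 x := (inr (inr (inr (inr (inl (inr x)))))).
Local Notation Jp1 x := (inr (inr (inr (inr (inr x))))).
Local Notation ord n k := (@Ordinal n k isT).

(* [rho] and [kappa] place the rows and the columns: they differ because the
   leading blocks [0 A; A^* 0] have to become identity blocks. *)
Definition rho (x : pencil_index) : block_index :=
  match x with
  | inl (inl i) =>
    match i with
    | B1 k => Jp1 (k, ord 4 0) | B2 k => Np2 (k, ord 3 0) | B3 k => Np3 (k, ord 3 2)
    | B4 k => Np4 (k, ord 1 0) | B5 k => Jp5 (k, ord 2 1) | B6 k => Z0 (lshift (q1 s) k)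
    end
  | inl (inr j) =>
    match j with
    | B1 k => Z0 (rshift (p6 s) k) | B2 k => Jq2 (k, ord 2 1) | B3 k => Jp1 (k, ord 4 1)
    | B4 k => Np2 (k, ord 3 2) | B5 k => Np3 (k, ord 3 0) | B6 k => Nq6 (k, ord 1 0)
    end
  | inr (inl i) =>
    match i with
    | B1 k => Jp1 (k, ord 4 2) | B2 k => Np2 (k, ord 3 1) | B3 k => Nm3 (k, ord 1 0)
    | E4 k => Jp5 (k, ord 2 0)
    end
  | inr (inr i) =>
    match i with
    | B1 k => Jq2 (k, ord 2 0) | B2 k => Jp1 (k, ord 4 3) | B3 k => Np3 (k, ord 3 1)
    | E4 k => Nn4 (k, ord 1 0)
    end
  end.

Definition kappa (x : pencil_index) : block_index :=
  match x with
  | inl (inl i) =>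
    match i with
    | B1 k => Jp1 (k, ord 4 0) | B2 k => Np2 (k, ord 3 2) | B3 k => Np3 (k, ord 3 0)
    | B4 k => Nq6 (k, ord 1 0) | B5 k => Jp5 (k, ord 2 0) | B6 k => Z0 (lshift (q1 s) k)
    end
  | inl (inr j) =>
    match j with
    | B1 k => Z0 (rshift (p6 s) k) | B2 k => Jq2 (k, ord 2 0) | B3 k => Jp1 (k, ord 4 1)
    | B4 k => Np2 (k, ord 3 0) | B5 k => Np3 (k, ord 3 2) | B6 k => Np4 (k, ord 1 0)
    end
  | inr (inl i) =>
    match i with
    | B1 k => Jp1 (k, ord 4 2) | B2 k => Np2 (k, ord 3 1) | B3 k => Nm3 (k, ord 1 0)
    | E4 k => Jp5 (k, ord 2 1)
    end
  | inr (inr i) =>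
    match i with
    | B1 k => Jq2 (k, ord 2 1) | B2 k => Jp1 (k, ord 4 3) | B3 k => Np3 (k, ord 3 1)
    | E4 k => Nn4 (k, ord 1 0)
    end
  end.

(** Equal cardinalities reduce the bijectivity of [rho] and [kappa] to injectivity, that is, to a
    single cancellation with a candidate inverse. *)
Lemma card_block_index : #|block_index| = #|pencil_index|.
Proof.
rewrite !(card_sum, card_prod, card_ord) /q3 /q4 /q5 /q6 /m1 /m2 /m4 /n1 /n2 /n3; lia.
Qed.

(** The match is on the value of the position inside a block, an ordinal carrying a proof as well;
    the final branch stands for the last position. *)
Definition rho_inv (x : block_index) : pencil_index :=
  match x with
  | Z0 k => match split k with inl i => inl (inl (B6 i)) | inr j => inl (inr (B1 j)) end
  | Np4 (k, _) => inl (inl (B4 k))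
  | Nq6 (k, _) => inl (inr (B6 k))
  | Nm3 (k, _) => inr (inl (B3 k))
  | Nn4 (k, _) => inr (inr (E4 k))
  | Np2 (k, i) => match val i with
    | 0%N => inl (inl (B2 k)) | 1%N => inr (inl (B2 k)) | _ => inl (inr (B4 k)) end
  | Np3 (k, i) => match val i with
    | 0%N => inl (inr (B5 k)) | 1%N => inr (inr (B3 k)) | _ => inl (inl (B3 k)) end
  | Jp5 (k, i) => if val i is 0%N then inr (inl (E4 k)) else inl (inl (B5 k))
  | Jq2 (k, i) => if val i is 0%N then inr (inr (B1 k)) else inl (inr (B2 k))
  | Jp1 (k, i) => match val i with
    | 0%N => inl (inl (B1 k)) | 1%N => inl (inr (B3 k)) | 2%N => inr (inl (B1 k))
    | _ => inr (inr (B2 k)) end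
  end.

Definition kappa_inv (x : block_index) : pencil_index :=
  match x with
  | Z0 k => match split k with inl i => inl (inl (B6 i)) | inr j => inl (inr (B1 j)) end
  | Np4 (k, _) => inl (inr (B6 k))
  | Nq6 (k, _) => inl (inl (B4 k))
  | Nm3 (k, _) => inr (inl (B3 k))
  | Nn4 (k, _) => inr (inr (E4 k))
  | Np2 (k, i) => match val i with
    | 0%N => inl (inr (B4 k)) | 1%N => inr (inl (B2 k)) | _ => inl (inl (B2 k)) end
  | Np3 (k, i) => match val i with
    | 0%N => inl (inl (B3 k)) | 1%N => inr (inr (B3 k)) | _ => inl (inr (B5 k)) end
  | Jp5 (k, i) => if val i is 0%N then inl (inl (B5 k)) else inr (inl (E4 k))
  | Jq2 (k, i) => if val i is 0%N then inl (inr (B2 k)) else inr (inr (B1 k))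
  | Jp1 (k, i) => match val i with
    | 0%N => inl (inl (B1 k)) | 1%N => inl (inr (B3 k)) | 2%N => inr (inl (B1 k))
    | _ => inr (inr (B2 k)) end
  end.

Lemma rho_bij : bijective rho.
Proof.
apply: inj_card_bij; last by rewrite card_block_index.
apply: (can_inj (g := rho_inv)).
case=> [[[i|[i|[i|[i|[i|i]]]]]|[i|[i|[i|[i|[i|i]]]]]]|[[i|[i|[i|i]]]|[i|[i|[i|i]]]]];
  by rewrite //= ?(unsplitK (inl _)) ?(unsplitK (inr _)).
Qed.

Lemma kappa_bij : bijective kappa.
Proof.
apply: inj_card_bij; last by rewrite card_block_index.
apply: (can_inj (g := kappa_inv)).
case=> [[[i|[i|[i|[i|[i|i]]]]]|[i|[i|[i|[i|[i|i]]]]]]|[[i|[i|[i|i]]]|[i|[i|[i|i]]]]];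
  by rewrite //= ?(unsplitK (inl _)) ?(unsplitK (inr _)).
Qed.

(** The sums are nested like the concatenations that [nseqD] produces in [to_kcf_blocks], so that
    [to_kcf_dsum] applies summand by summand. This is why [N_1] comes in four families and [J_2(0)]
    in two. *)
Definition block_lead :=
  dsum (kb_lead (KZero (p6 s + q1 s) (p6 s + q1 s)))
  (dsum (dsum (dsum (dsum (@dfam C (p4 s) _ _ (fun=> kb_lead (KN 1)))
                          (@dfam C (q6 s) _ _ (fun=> kb_lead (KN 1))))
                    (@dfam C (m3 s) _ _ (fun=> kb_lead (KN 1))))
              (@dfam C (n4 s) _ _ (fun=> kb_lead (KN 1))))
  (dsum (@dfam C (p2 s) _ _ (fun=> kb_lead (KN 3)))
  (dsum (@dfam C (p3 s) _ _ (fun=> kb_lead (KN 3)))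
  (dsum (dsum (@dfam C (p5 s) _ _ (fun=> kb_lead (KJ 2 0)))
              (@dfam C (q2 s) _ _ (fun=> kb_lead (KJ 2 0))))
        (dfam (fun j => quad_lead (a 0 j))))))).

Definition block_trail :=
  dsum (kb_trail (KZero (p6 s + q1 s) (p6 s + q1 s)))
  (dsum (dsum (dsum (dsum (@dfam C (p4 s) _ _ (fun=> kb_trail (KN 1)))
                          (@dfam C (q6 s) _ _ (fun=> kb_trail (KN 1))))
                    (@dfam C (m3 s) _ _ (fun=> kb_trail (KN 1))))
              (@dfam C (n4 s) _ _ (fun=> kb_trail (KN 1))))
  (dsum (@dfam C (p2 s) _ _ (fun=> kb_trail (KN 3)))
  (dsum (@dfam C (p3 s) _ _ (fun=> kb_trail (KN 3)))
  (dsum (dsum (@dfam C (p5 s) _ _ (fun=> kb_trail (KJ 2 0)))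
              (@dfam C (q2 s) _ _ (fun=> kb_trail (KJ 2 0))))
        (dfam (fun j => quad_trail (b 0 j) (c 0 j))))))).

(** A check over all pairs of blocks. Rows [p2], [m2], [q4] against columns [q4], [m2], [p2] put the
    ones of [A], [I], [A^*] on the diagonal and those of [B], [B^*] just above it, which is [N_3].
    Rows [m4], [p5] against columns [p5], [m4] put [B^*], [B] on the diagonal of the trailing matrix
    and a one of [I] above that of the leading one, which is [J_2(0)]. Exchanging [A] with [A^*] and
    [B] with [C^*] gives the other families. *)
Lemma lead_entry_block x y : lead_entry x y = block_lead (rho x) (kappa y).
Proof.
case: x => [[[i|[i|[i|[i|[i|i]]]]]|[i|[i|[i|[i|[i|i]]]]]]|[[i|[i|[i|i]]]|[i|[i|[i|i]]]]];
case: y => [[[j|[j|[j|[j|[j|j]]]]]|[j|[j|[j|[j|[j|j]]]]]]|[[j|[j|[j|j]]]|[j|[j|[j|j]]]]];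
  rewrite /= /dfam /ifeq /= ?mxE //= ?(inj_eq inl_inj, inj_eq inr_inj)
    ?mulr0n ?mulr1n ?addr0 ?add0r ?if_same //;
  solve [exact: ifeq1 | exact: ifeqC | exact: ifeq_rowC | by case: eqP => [->|]].
Qed.

Lemma trail_entry_block x y : trail_entry x y = block_trail (rho x) (kappa y).
Proof.
case: x => [[[i|[i|[i|[i|[i|i]]]]]|[i|[i|[i|[i|[i|i]]]]]]|[[i|[i|[i|i]]]|[i|[i|[i|i]]]]];
case: y => [[[j|[j|[j|[j|[j|j]]]]]|[j|[j|[j|[j|[j|j]]]]]]|[[j|[j|[j|j]]]|[j|[j|[j|j]]]]];
  rewrite /= /dfam /ifeq /= ?mxE //= ?(inj_eq inl_inj, inj_eq inr_inj)
    ?mulr0n ?mulr1n ?addr0 ?add0r ?if_same //;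
  solve [exact: ifeq1 | exact: ifeqC | exact: ifeq_rowC | by case: eqP => [->|]].
Qed.

Lemma strict_equiv_blocks : strict_equiv lead_entry trail_entry block_lead block_trail.
Proof.
apply: strict_equiv_sym (strict_equiv_reindex rho_bij kappa_bij _ _).
  exact: lead_entry_block.
exact: trail_entry_block.
Qed.

Lemma to_kcf_blocks (l : 'I_(p1 s) -> C) :
  (forall j, a 0 j != 0) -> (forall j, b 0 j != 0) -> (forall j, c 0 j != 0) ->
  (forall j, l j ^+ 2 = a 0 j / (b 0 j * c 0 j)) ->
  to_kcf block_lead block_trail
    (KZero (p6 s + q1 s) (p6 s + q1 s)
     :: nseq (p4 s + q6 s + m3 s + n4 s) (KN 1)
     ++ nseq (p2 s) (KN 3)
     ++ nseq (p3 s) (KN 3)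
     ++ nseq (p5 s + q2 s) (KJ 2 0)
     ++ flatten [seq [:: KJ 1 (l j); KJ 1 (- l j);
                         KJ 1 ('i * l j); KJ 1 (- 'i * l j)]
                | j <- enum 'I_(p1 s)]).
Proof.
move=> a0 b0 c0 el; rewrite !nseqD -cat1s.
apply: to_kcf_dsum; first exact: to_kcf1.
do ?[apply: to_kcf_dsum]; try exact: to_kcf_dfam_const.
by apply: to_kcf_dfam => j; apply: to_kcf_quad.
Qed.
End SigmaPencil.

Theorem theorem5p3 (R : realType) (p q m n : nat)
    (A : 'M[R[i]]_(p, q)) (B : 'M[R[i]]_(p, m)) (C : 'M[R[i]]_(n, q))
    (D : rsvd A B C) :
  let s := rsvd_sizes_of A B C in
  let sqrt_sigma (j : 'I_(p1 s)) : R[i] := real_complex R (Num.sqrt (rsv D j)) in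
  (p5 s + q2 s = m4 s + n1 s)%N /\
  has_kcf (rsvd_pencil_lead m n A) (rsvd_pencil_trail B C)
    (KZero (p6 s + q1 s) (p6 s + q1 s)
     :: nseq (p4 s + q6 s + m3 s + n4 s) (KN 1)
     ++ nseq (p2 s) (KN 3)
     ++ nseq (p3 s) (KN 3)
     ++ nseq (p5 s + q2 s) (KJ 2 0)
     ++ flatten [seq [:: KJ 1 (sqrt_sigma j); KJ 1 (- sqrt_sigma j);
                         KJ 1 ('i * sqrt_sigma j); KJ 1 (- 'i * sqrt_sigma j)]
                | j <- enum 'I_(p1 s)]).
Proof.
(* The equality of counts holds by computation, [m4 s] and [n1 s] being [p5 s] and [q2 s]. *)
move=> s l; split=> //.
have cJ (x : 'rV[R]_(p1 s)) j : (forall k, 0 < x 0 k) ->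
    (map_mx (real_complex R) x 0 j)^* = map_mx (real_complex R) x 0 j.
  by move=> x0; rewrite mxE; apply/CrealP/ger0_real; rewrite ler0c ltW.
have c0 (x : 'rV[R]_(p1 s)) j : (forall k, 0 < x 0 k) ->
    map_mx (real_complex R) x 0 j != 0.
  by move=> x0; rewrite mxE fmorph_eq0 gt_eqF.
have [[a0 b0] g0] := (rsvd_alpha_gt0 D, rsvd_beta_gt0 D, rsvd_gamma_gt0 D).
apply: has_kcf_strict_equiv.
apply: strict_equiv_trans (pencil_congr _ _ _ (rsvd_X_unit D) (rsvd_Y_unit D)
  (rsvd_U_unitary D) (rsvd_V_unitary D)) _.
have tX : (rsvd_X D)^t* *m (invmx (rsvd_X D))^t* = 1%:M.
  by rewrite -map_mxM -trmx_mul mulVmx ?rsvd_X_unit // trmx1 map_mx1.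
have UU : (rsvd_U D)^t* *m rsvd_U D = 1%:M.
  exact/mulmx1C/unitarymxP/rsvd_U_unitary.
have VV : (rsvd_V D)^t* *m rsvd_V D = 1%:M.
  exact/mulmx1C/unitarymxP/rsvd_V_unitary.
set A' := _ *m A *m _; set B' := _ *m B *m _; set C' := _ *m C *m _.
have -> : A' = castmx (rsvd_psum D, rsvd_qsum D)
             (Sigma_alpha (map_mx (real_complex R) (rsvd_alpha D))).
  (* [A] occurs in the type of [D], hence also on the right of [rsvd_factA D]; [congr1] replaces
     only the middle factor of the product. *)
  apply: etrans (congr1 (fun M => (rsvd_X D)^t* *m M *m rsvd_Y D) (rsvd_factA D)) _.
  rewrite !mulmxA tX mul1mx -mulmxA.
  by rewrite mulVmx ?rsvd_Y_unit // mulmx1.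
have -> : B' = castmx (rsvd_psum D, rsvd_msum D)
             (Sigma_beta (map_mx (real_complex R) (rsvd_beta D))).
  apply: etrans (congr1 (fun M => (rsvd_X D)^t* *m M *m rsvd_U D) (rsvd_factB D)) _.
  by rewrite !mulmxA tX mul1mx -mulmxA UU mulmx1.
have -> : C' = castmx (rsvd_nsum D, rsvd_qsum D)
             (Sigma_gamma (map_mx (real_complex R) (rsvd_gamma D))).
  apply: etrans (congr1 (fun M => (rsvd_V D)^t* *m M *m rsvd_Y D) (rsvd_factC D)) _.
  rewrite !mulmxA VV mul1mx -mulmxA.
  by rewrite mulVmx ?rsvd_Y_unit // mulmx1.
apply: strict_equiv_trans (pencil_cast _ _ _ _ _ _ _) _.
apply: strict_equiv_trans (strict_equiv_entries _ _ _) _; try by move=> j; apply: cJ.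
apply: strict_equiv_trans (strict_equiv_blocks _ _ _) _.
apply: to_kcf_blocks => j; try exact: c0.
(* The real square root squares back to the restricted singular value, which is positive; the
   identity is carried over to [R[i]] by the embedding. *)
rewrite !mxE -rmorphXn /= sqr_sqrtr ?fmorph_div ?rmorphM //.
by rewrite /rsv ltW // divr_gt0 ?mulr_gt0.
Qed.
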